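(* Let $(G,\omega)$ be a weighted digraph without loops, let $H_1,\dots,H_s$ be the undirectizations of its strongly connected or single node components, let $V$ be its square-rooted weighted Hashimoto matrix, let $\sigma$ be the smallest positive entry of $V$ (when $V\ne0$), and let $r$ be the radius of convergence of $\sum_{k=0}^\infty t^kp_k(A)$. Then: (a) if every $H_i$ is a tree or an isolated node, then $r=\infty$; (b) if no $H_i$ has more than one cycle but at least one $H_i$ has exactly one cycle, then $r\le1/\sigma$; (c) if some $H_i$ has more than one cycle, then $r<1/\sigma$.
   Context: A weighted digraph: digraph $G$ (no loops or multiple edges) with $\omega:E\to(0,\infty)$. Weight of a walk = product of weights of its edges (with repetition); non-backtracking walk: $v_{r+2}\ne v_r$ for all $r$. $p_k(A)_{ij}$ = sum of weights of non-backtracking walks of length $k$ from $i$ to $j$, $p_0(A)=I$. $V_{ef}=\sqrt{\omega(e)\omega(f)}$ if $e=(i,j),f=(j,k)$ with $k\ne i$, else $0$. Components: induced subgraphs on classes of ''$i=j$ or mutually reachable by directed walks''. Undirectization: undirected simple graph with edge $\{i,j\}$ whenever $(i,j)$ or $(j,i)$ is an edge; a cycle is a closed path of length $\ge3$ up to cyclic permutations and reversal. *)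

(* Defs.v *)
From HB Require Import structures.
From mathcomp Require Import all_boot all_order all_algebra.
From mathcomp Require Import all_classical all_reals all_analysis.
Set Implicit Arguments. Unset Strict Implicit. Unset Printing Implicit Defensive.
Import Order.TTheory GRing.Theory Num.Theory.
Import numFieldNormedType.Exports.
Local Open Scope ring_scope.
Local Open Scope classical_set_scope.

(* A weighted digraph on a finite vertex set T is encoded by a weight
   function w : T -> T -> R with w i j >= 0; (i,j) is an edge iff
   0 < w i j, and then omega((i,j)) = w i j.  No multiple edges is automatic;
   "no loops" is the hypothesis w i i = 0. *)

Section Defs.
Variables (R : realType) (T : finType) (w : T -> T -> R).

Definition is_edge (i j : T) : bool := 0 < w i j.

Definition steps (s : seq T) : seq (T * T) := zip s (behead s).

Definition nb_walk (s : seq T) : bool :=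
  all (fun e => is_edge e.1 e.2) (steps s) &&
  all (fun p => p.1 != p.2) (zip s (drop 2 s)).

Definition walk_weight (s : seq T) : R :=
  \prod_(e <- steps s) w e.1 e.2.

(* p_k(A)_{ij}: sum of weights of non-backtracking walks of length k from i
   to j (walks of length k = (k+1)-tuples of vertices) *)
Definition pk (k : nat) (i j : T) : R :=
  \sum_(s : (k.+1).-tuple T | [&& nb_walk s, head i s == i & last i s == j])
     walk_weight s.

Definition edge_t := {e : T * T | is_edge e.1 e.2}.

Definition hashiV (e f : edge_t) : R :=
  if ((val e).2 == (val f).1) && ((val f).2 != (val e).1)
  then Num.sqrt (w (val e).1 (val e).2 * w (val f).1 (val f).2)
  else 0.

(* the smallest positive entry of V (meaningful when V <> 0) *)
Definition pos_entries : seq R :=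
  [seq hashiV ef.1 ef.2 | ef <- enum [pred ef : edge_t * edge_t |
                                       0 < hashiV ef.1 ef.2]].
Definition sigmaV : R :=
  \big[Num.min/head 0 pos_entries]_(x <- pos_entries) x.

Definition conv_at (t : R) : Prop :=
  forall i j : T, cvg ((fun n => \sum_(0 <= k < n) t ^+ k * pk k i j) @ \oo).

Definition conv_radius : \bar R :=
  ereal_sup [set (`|t|)%:E | t in conv_at].

Definition reach : rel T := connect is_edge.
Definition scc (x : T) : {set T} := [set y | reach x y && reach y x].

Definition uadj (C : {set T}) : rel T :=
  fun i j => [&& i \in C, j \in C, i != j & is_edge i j || is_edge j i].

Definition is_cycle (C : {set T}) (c : seq T) : bool :=
  [&& (3 <= size c)%N, uniq c, all (mem C) c & cycle (uadj C) c].

Definition same_cycle (c d : seq T) : Prop :=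
  exists n, d = rot n c \/ d = rot n (rev c).

Definition no_cycle (C : {set T}) : Prop := forall c, ~~ is_cycle C c.
Definition exactly_one_cycle (C : {set T}) : Prop :=
  exists c, is_cycle C c /\ forall d, is_cycle C d -> same_cycle c d.
Definition more_than_one_cycle (C : {set T}) : Prop :=
  exists c d, [/\ is_cycle C c, is_cycle C d & ~ same_cycle c d].

Definition uconnected (C : {set T}) : Prop :=
  forall i j, i \in C -> j \in C -> connect (uadj C) i j.
Definition is_tree (C : {set T}) : Prop := uconnected C /\ no_cycle C.
Definition isolated_node (C : {set T}) : Prop := #|C| = 1%N.

End Defs.

(* Main.v *)
(** A non-backtracking walk is a walk of the relation [nbstep] on directed edges,
    and a closed such walk of length n has weight at least sigma^n.  (a) A
    non-backtracking walk with a repeated vertex contains a directed simple cycle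
    of length at least 3, so without such cycles p_k = 0 for k >= #|T|.  (b) If
    the undirectization of a strong component has a cycle, then the component has
    a directed cycle of length at least 3, since a one-way edge lies on one; its
    powers force r <= 1/sigma.  (c) A second cycle yields an edge f, lying on a
    directed cycle, that is no edge of the first directed cycle c.  Then f and the
    edges of c reach each other by [nbstep], so some edge of c has two successors
    leading back to it.  Running through the two loops in either order gives two
    closed walks of a common length n, hence 2^k closed walks of length nk, and r
    is at most 2^(-1/n)/sigma. *)
Require Import Defs.
From HB Require Import structures.
From mathcomp Require Import all_boot all_order all_algebra.
From mathcomp Require Import ring lra.
From mathcomp Require Import all_classical all_reals all_analysis.
Import Order.TTheory GRing.Theory Num.Theory.
Set Implicit Arguments. Unset Strict Implicit. Unset Printing Implicit Defensive.

(** * Non-backtracking steps between directed cycles *)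

(** For [E = is_edge w] this is the support of the Hashimoto matrix, as a relation on all pairs of
    vertices so that walks are plain [path]s without a subtype of edges. *)
Definition nbstep (T : eqType) (E : rel T) : rel (T * T) := fun e f =>
  [&& E e.1 e.2, E f.1 f.2, e.2 == f.1 & f.2 != e.1].

Definition dcycle (T : eqType) (E : rel T) (c : seq T) : bool :=
  [&& 2 < size c, uniq c & cycle E c].

(** Orientation is ignored, since cycles of the undirectization are compared up to reversal. *)
Definition cycle_edge (T : eqType) (c : seq T) (x y : T) : bool :=
  ((x \in c) && (next c x == y)) || ((y \in c) && (next c y == x)).

Lemma next_next_neq (T : eqType) (c : seq T) x :
  uniq c -> 2 < size c -> x \in c -> next c (next c x) != x.
Proof.
move=> Uc c3 xc; have [i s Dc] := rot_to xc.
rewrite -!(next_rot i Uc) Dc.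
move: Uc c3; rewrite -(rot_uniq i) -(size_rot i) Dc {Dc}.
case: s => [|y [|z s]] //=.
rewrite !inE eqxx !negb_or => /andP[/and3P[xy xz _] _] _.
by rewrite [y == x]eq_sym (negPf xy) eqxx eq_sym.
Qed.

Lemma connect_anti (T U : finType) (r : rel T) (r' : rel U) (phi : T -> U) :
  (forall a b, r a b -> r' (phi b) (phi a)) ->
  forall a b, connect r a b -> connect r' (phi b) (phi a).
Proof.
move=> anti a b /connectP[p rp ->] {b}.
elim: p a rp => //= b p IHp a /andP[rab /IHp rp].
exact: connect_trans rp (connect1 (anti _ _ rab)).
Qed.

Lemma connect_last (T : finType) (r : rel T) a b :
  connect r a b -> a = b \/ exists2 d, connect r a d & r d b.
Proof.
case/connectP=> p; case: (lastP p) => [_ ->|q d]; first by left.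
rewrite rcons_path last_rcons => /andP[rq rd] ->; right.
by exists (last a q) => //; apply/connectP; exists q.
Qed.

(* Being blocked at [g.2] means wanting to return to [g.1], which is itself
   reached by the predecessor of [g]. *)
Lemma nb_reach_vertex (T : finType) (E : rel T) (f g0 : T * T) z :
    connect (nbstep E) f g0 -> nbstep E g0 f -> connect E f.2 z ->
  exists2 g, connect (nbstep E) f g & E g.1 g.2 /\ g.2 = z.
Proof.
move=> fg0 g0f /connectP[p]; elim/last_ind: p z => [z _ -> /=|p u IHp z].
  by exists f => //; case/and4P: g0f.
rewrite rcons_path last_rcons => /andP[Ep Eu] ->.
have [g fg [Eg gl]] := IHp _ Ep erefl; rewrite -{}gl in Eu.
have [ug|ug] := eqVneq u g.1; last first.
  exists (g.2, u) => //; apply: connect_trans fg (connect1 _).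
  by rewrite /nbstep /= Eg Eu eqxx.
have [g' fg' /and4P[Eg' _ /eqP g'g _]]:
    exists2 g', connect (nbstep E) f g' & nbstep E g' g.
  by case/connect_last: fg => [<-|[g1 fg1 g1g]]; [exists g0 | exists g1].
by exists g' => //; split=> //; rewrite g'g ug.
Qed.

(* Otherwise, following the walk from [f], no reached edge could end in [D],
   because it would then turn into [D]; but every vertex that [f.2] reaches is the
   end of a reached edge. *)
Lemma nb_reach_orbit (T : finType) (E : rel T) (D : {pred T}) (nx : T -> T)
    (f g0 : T * T) z :
    {in D, forall v, nx v \in D /\ E v (nx v)} ->
    connect (nbstep E) f g0 -> nbstep E g0 f ->
    ~~ ((f.2 \in D) && (nx f.2 == f.1)) ->
    connect E f.2 z -> z \in D ->
  exists2 v, v \in D & connect (nbstep E) f (v, nx v).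
Proof.
move=> DE fg0 g0f nf fz zD.
have Ef : E f.1 f.2 by case/and4P: g0f.
have [/exists_inP //|none] := boolP [exists v in D, connect (nbstep E) f (v, nx v)].
have turn g : connect (nbstep E) f g -> E g.1 g.2 -> g.2 \in D -> nx g.2 = g.1.
  move=> fg Eg gD; apply/eqP; apply: contraNT none => ng.
  apply/exists_inP; exists g.2 => //; apply: connect_trans fg (connect1 _).
  by have [_ E2] := DE _ gD; rewrite /nbstep /= Eg E2 eqxx.
have notD p : path (nbstep E) f p -> (last f p).2 \notin D.
  elim/last_ind: p => [_ /=|p h IHp].
    apply: contra nf => fD; rewrite fD /=; apply/eqP.
    exact: turn (connect0 _ _) Ef fD.
  rewrite rcons_path last_rcons => /andP[fp ph].
  have fh : connect (nbstep E) f h.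
    by apply: connect_trans (connect1 ph); apply/connectP; exists p.
  case/and4P: (ph) => _ Eh /eqP lh _; apply: contra (IHp fp) => hD.
  by rewrite lh -(turn _ fh Eh hD); case: (DE _ hD).
have [g /connectP[p fp ->] [_ gz]] := nb_reach_vertex fg0 g0f fz.
by move: (notD _ fp); rewrite gz zD.
Qed.

Lemma dcycle_nbstep (T : finType) (E : rel T) (c : seq T) :
  dcycle E c -> cycle (nbstep E) [seq (v, next c v) | v <- c].
Proof.
case/and3P=> c3 Uc Ec; rewrite cycle_map.
apply: sub_in_cycle (allss c) (cycle_next Uc) => x y xc yc /= /eqP <-.
rewrite /nbstep /= eqxx !(next_cycle Ec) ?mem_next //=.
exact: next_next_neq.
Qed.

(** Time reversal of [nb_reach_orbit]: swapping the ends of all edges turns [nbstep E] into the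
    converse of [nbstep E']. *)
Lemma nb_from_orbit (T : finType) (E : rel T) (D : {pred T}) (pv : T -> T)
    (f g0 : T * T) z :
    {in D, forall v, pv v \in D /\ E (pv v) v} ->
    connect (nbstep E) g0 f -> nbstep E f g0 ->
    ~~ ((f.1 \in D) && (pv f.1 == f.2)) ->
    connect E z f.1 -> z \in D ->
  exists2 v, v \in D & connect (nbstep E) (pv v, v) f.
Proof.
move=> DE gf fg nf zf zD; pose E' : rel T := fun x y => E y x.
pose swap (e : T * T) := (e.2, e.1).
have swapK : cancel swap swap by case.
have swapE e e' : nbstep E' (swap e) (swap e') = nbstep E e' e.
  by rewrite /nbstep /E' /=; case: eqVneq => [->|]; rewrite ?andbF // andbCA eq_sym
    [_ == e'.1]eq_sym.
have [v vD cv] : exists2 v, v \in D & connect (nbstep E') (swap f) (v, pv v).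
  apply: (@nb_reach_orbit T E' D pv (swap f) (swap g0) z) => //.
  - by apply: connect_anti gf => a b; rewrite swapE.
  - by rewrite swapE.
  - by apply: (@connect_anti _ _ E E' id) zf.
exists v => //; rewrite -[f]swapK.
by apply: (connect_anti (phi := swap)) cv => a b; rewrite -swapE !swapK.
Qed.

Lemma cycle_pred (T : finType) (r : rel T) c x :
  cycle r c -> x \in c -> exists2 y, connect r x y & r y x.
Proof.
move=> rc xc; exists (prev c x); last exact: prev_cycle.
by apply: (connect_cycle rc); rewrite ?mem_prev.
Qed.

Lemma cycle_succ (T : finType) (r : rel T) c x :
  cycle r c -> x \in c -> exists2 y, connect r y x & r x y.
Proof.
move=> rc xc; exists (next c x); last exact: next_cycle.
by apply: (connect_cycle rc); rewrite ?mem_next.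
Qed.

Lemma first_exit (T : finType) (r : rel T) (A : {pred T}) a b :
    connect r a b -> a \in A -> b \notin A ->
  exists x y, [/\ x \in A, y \notin A, r x y & connect r y b].
Proof.
case/connectP=> p rp -> {b}; elim: p a rp => [a _ /= -> //|u p IHp a] /=.
case/andP=> au rp aA lA; have [uA|uA] := boolP (u \in A).
  exact: (IHp u).
by exists a, u; split=> //; apply/connectP; exists p.
Qed.

(** The edge [(x, y)] of [d] reaches an edge of [c] and is reached from one. The latter walk leaves
    the edges of [c] at some [e]; one successor of [e] continues this walk, the other follows [c],
    and both lead back to [e]. *)
Lemma two_dcycles_branch (T : finType) (E : rel T) (c d : seq T) x y :
    dcycle E c -> dcycle E d -> x \in d -> y = next d x -> ~~ cycle_edge c x y ->
    (forall u v, u \in c -> v \in d -> connect E u v /\ connect E v u) ->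
  exists e f1 f2, [/\ f1 != f2, nbstep E e f1, nbstep E e f2,
                      connect (nbstep E) f1 e & connect (nbstep E) f2 e].
Proof.
move=> Cc Cd xd ->{y} nxy cd.
have fd : (x, next d x) \in [seq (v, next d v) | v <- d] by apply: map_f.
have Hd := dcycle_nbstep Cd; have Hc := dcycle_nbstep Cc.
have [g1 fg1 g1f] := cycle_pred Hd fd.
have [g2 g2f fg2] := cycle_succ Hd fd.
case/and3P: (Cc) => c3 Uc Ec.
have [z zc] : exists z, z \in c by case: (c) c3 => // z s; exists z; rewrite mem_head.
have nd : next d x \in d by rewrite mem_next.
(* [nyx] keeps the edge from being the reverse of an edge of [c], as both orbit lemmas require;
   [nxy] puts it outside the edge set [S]. *)
move: nxy; rewrite /cycle_edge negb_or => /andP[nxy nyx].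
have [v1 v1c fv1] : exists2 v, v \in c & connect (nbstep E) (x, next d x) (v, next c v).
  apply: (@nb_reach_orbit T E [in c] (next c) _ g1 z) => //.
  - by move=> v vc; rewrite mem_next; split=> //; apply: next_cycle.
  - by have [] := cd z (next d x) zc nd.
have [v2 v2c fv2] : exists2 v, v \in c & connect (nbstep E) (prev c v, v) (x, next d x).
  apply: (@nb_from_orbit T E [in c] (prev c) _ g2 z) => //.
  - by move=> v vc; rewrite mem_prev; split=> //; apply: prev_cycle.
  - apply: contra nyx => /= /andP[xc /eqP <-].
    by rewrite mem_prev xc next_prev ?eqxx.
  - by have [] := cd z x zc xd.
set S := [seq (v, next c v) | v <- c] in Hc.
have inS v : v \in c -> (v, next c v) \in S by move=> vc; apply: map_f.
have pS : (prev c v2, v2) \in S.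
  by rewrite -{2}(next_prev Uc v2); apply: inS; rewrite mem_prev.
have fS : (x, next d x) \notin S.
  by apply: contra nxy => /mapP[v vc [-> ->]]; rewrite vc eqxx.
have [e [f1 [eS f1S ef1 f1f]]] := first_exit fv2 pS fS.
exists e, f1, (next S e); split=> //.
- by apply: contraNneq f1S => ->; rewrite mem_next.
- exact: next_cycle.
- apply: connect_trans f1f (connect_trans fv1 _).
  exact: (connect_cycle Hc) (inS _ v1c) eS.
- by apply: (connect_cycle Hc); rewrite ?mem_next.
Qed.

(** * Directed cycles obtained from cycles of the undirectization *)

(** A simple [E']-path from [y] to [x] is closed by the edge [(x, y)]; it has at least two steps
    because [E' y x] fails. Taking [E' = E] serves one-way edges, and a smaller [E'] allows a
    two-way edge to be deleted first. *)
Lemma dcycle_through (T : finType) (E E' : rel T) x y :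
    subrel E' E -> E x y -> x != y -> ~~ E' y x -> connect E' y x ->
  exists s, dcycle E (x :: y :: s).
Proof.
move=> E'E Exy xy nyx /connectP[p0 E'p0 lp0].
case: (shortenP E'p0) lp0 => p E'p Up _.
case: (lastP p) E'p Up => [_ _ /= /esym/eqP|q z].
  by rewrite eq_sym (negPf xy).
rewrite last_rcons rcons_path => /andP[E'q E'z] Uq zx; rewrite -{z}zx in E'z Uq *.
exists q; apply/and3P; split.
- by case: q E'z {E'q Uq} => //=; rewrite (negPf nyx).
- rewrite -(rot_uniq 1) rot1_cons.
  by move: Uq; rewrite /= rcons_uniq mem_rcons inE negb_or.
- by rewrite /= Exy rcons_path (sub_path E'E) //= E'E.
Qed.

(* Removing the edge {x, next d x} keeps [next d x] connected to [x]: the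
   remaining edges of [d] are either bidirectional or lie on [c]. *)
Lemma cycle_edgeC (T : eqType) (c : seq T) x y : cycle_edge c x y = cycle_edge c y x.
Proof. by rewrite /cycle_edge orbC. Qed.

Lemma second_dcycle (T : finType) (E : rel T) (c d : seq T) :
    irreflexive E -> dcycle E c -> 2 < size d -> uniq d ->
    cycle (fun x y => E x y || E y x) d -> {in d &, forall x y, connect E x y} ->
    (exists2 x, x \in d & ~~ cycle_edge c x (next d x)) ->
  exists x y s, [/\ x \in d, ~~ cycle_edge c x y & dcycle E (x :: y :: s)].
Proof.
move=> irrE /and3P[c3 Uc Ec] d3 Ud Ed conn [x xd nx].
have oneway u v : u \in d -> v \in d -> ~~ cycle_edge c u v -> E u v -> ~~ E v u ->
  exists x y s, [/\ x \in d, ~~ cycle_edge c x y & dcycle E (x :: y :: s)].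
  move=> ud vd nuv Euv nvu; have uv : u != v by apply: contraTneq Euv => <-; rewrite irrE.
  have [s Cs] := dcycle_through (fun _ _ H => H) Euv uv nvu (conn _ _ vd ud).
  by exists u, v, s.
have [/exists_inP[u ud /andP[nu ow]]|/exists_inPn two] := boolP
   [exists u in d, ~~ cycle_edge c u (next d u) && ~~ (E u (next d u) && E (next d u) u)].
  have nd : next d u \in d by rewrite mem_next.
  have /orP[Eu|Eu] := next_cycle Ed ud; move: ow; rewrite Eu ?andbT /=.
    exact: oneway.
  by apply: oneway => //; rewrite cycle_edgeC.
set y := next d x in nx; have yd : y \in d by rewrite mem_next.
have /andP[Exy Eyx] : E x y && E y x by move: (two x xd); rewrite nx /= negbK.
have xy : x != y by apply: contraTneq Exy => <-; rewrite irrE.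
pose E' : rel T := fun a b => [&& E a b, (a, b) != (x, y) & (a, b) != (y, x)].
have E'c : cycle E' c.
  apply: cycle_from_next => // a ac; rewrite /E' (next_cycle Ec) //=.
  apply/andP; split; apply: contra nx => /eqP[<- <-]; rewrite /cycle_edge ac eqxx //=.
  by rewrite orbT.
have E'd a : a \in d -> a != x -> connect E' a (next d a).
  move=> ad ax; have [/orP[/andP[ac /eqP na]|/andP[nc /eqP na]]|na] :=
    boolP (cycle_edge c a (next d a)).
  - by apply: (connect_cycle E'c) => //; rewrite -na mem_next.
  - by apply: (connect_cycle E'c) => //; rewrite -na mem_next.
  (* An edge of [d] off [c] is two-way, and it is not the deleted one: otherwise [d] would turn back
     at [y]. *)
  apply: connect1; have := two a ad; rewrite na /= negbK => /andP[Ea _].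
  rewrite /E' Ea !xpair_eqE (negPf ax) /=; apply/negP => /andP[/eqP ay /eqP nax].
  by have := next_next_neq Ud d3 xd; rewrite -/y -ay nax eqxx.
have E'yx : connect E' y x.
  have [//|nE'] := boolP (connect E' y x).
  (* Following [d] from [y], the missing edge is never met, since it starts at [x], which is assumed
     unreachable. *)
  have reach p : fpath (next d) y p -> (last y p \in d) && connect E' y (last y p).
    elim/last_ind: p => [_ /=|p a IHp]; first by rewrite yd connect0.
    rewrite rcons_path last_rcons => /andP[/IHp /andP[ld yl] /eqP <-].
    rewrite mem_next ld; apply: (connect_trans yl); apply: E'd => //.
    by apply: contraNneq nE' => <-.
  have /connectP[p dp lp] : connect (frel (next d)) y x.
    exact: (connect_cycle (cycle_next Ud)).
  by have /andP[_] := reach p dp; rewrite -lp (negPf nE').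
have E'E : subrel E' E by move=> a b /andP[].
have nE' : ~~ E' y x by rewrite /E' eqxx !andbF.
have [s Cs] := dcycle_through E'E Exy xy nE' E'yx.
by exists x, y, s.
Qed.

(** If all edges of [d] are two-way, [d] is itself a directed cycle; otherwise [dcycle_through]
    applies to a one-way edge. Having [x] in [d] keeps the new cycle in the same strong
    component. *)
Lemma cycle_dcycle (T : finType) (E : rel T) (d : seq T) :
    irreflexive E -> 2 < size d -> uniq d ->
    cycle (fun x y => E x y || E y x) d -> {in d &, forall x y, connect E x y} ->
  exists x s, x \in d /\ dcycle E (x :: s).
Proof.
move=> irrE d3 Ud Ed conn.
have oneway u v : u \in d -> v \in d -> E u v -> ~~ E v u ->
  exists x s, x \in d /\ dcycle E (x :: s).
  move=> ud vd Euv nvu; have uv : u != v by apply: contraTneq Euv => <-; rewrite irrE.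
  have [s Cs] := dcycle_through (fun _ _ H => H) Euv uv nvu (conn _ _ vd ud).
  by exists u, (v :: s).
have [/exists_inP[u ud ow]|/exists_inPn two] := boolP
   [exists u in d, ~~ (E u (next d u) && E (next d u) u)].
  have nd : next d u \in d by rewrite mem_next.
  have /orP[Eu|Eu] := next_cycle Ed ud; move: ow; rewrite Eu ?andbT /=.
    exact: oneway.
  exact: oneway.
have {}Ed : cycle E d.
  apply: cycle_from_next => // u ud.
  by have := two u ud; rewrite negbK => /andP[].
case: d d3 Ud Ed {conn oneway two} => // x s d3 Ud Ed.
by exists x, s; rewrite mem_head /dcycle d3 Ud.
Qed.

(** Both sequences are rotations of the orbit of [x] under [next c]. *)
Lemma fcycle_next_rot (T : finType) (c d : seq T) x :
  uniq c -> uniq d -> fcycle (next c) d -> x \in d -> x \in c ->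
  exists n, d = rot n c.
Proof.
move=> Uc Ud cd xd xc.
have [n Dn] := orbit_rot_cycle (cycle_next Uc) Uc xc.
have [m Dm] := orbit_rot_cycle cd Ud xd.
exists (rot_add c n (size (rot n c) - m)).
by rewrite -rot_rot_add -[RHS]/(rotr m (rot n c)) -Dn Dm rotK.
Qed.

(** At each vertex [d] moves to a neighbour along [c], and the direction persists, so [d] is an
    orbit of [next c] or of [prev c], which is [next (rev c)]. *)
Lemma cycle_edges_sub (T : finType) (c d : seq T) :
    uniq c -> uniq d -> 2 < size d ->
    {in d, forall x, cycle_edge c x (next d x)} ->
  exists n, d = rot n c \/ d = rot n (rev c).
Proof.
move=> Uc Ud d3 dc.
have dcx x : x \in d -> x \in c /\ (next d x = next c x \/ next d x = prev c x).
  case/dc/orP => /andP[xc /eqP nx]; first by rewrite xc nx; split=> //; left.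
  by rewrite -{1}nx mem_next xc; split=> //; right; rewrite -{2}nx prev_next.
have [x xd] : exists x, x \in d.
  by case: (d) d3 => // x s; exists x; rewrite mem_head.
have [xc _] := dcx x xd.
(* whichever way [d] runs at one vertex, it cannot turn back at the next one *)
have propagate f g : cancel f g ->
    (forall z, z \in d -> next d z = f z \/ next d z = g z) ->
  next d x = f x -> fcycle f d.
  move=> fK dfg dx.
  have along p : fpath (next d) x p ->
     (last x p \in d) /\ next d (last x p) = f (last x p).
    elim/last_ind: p => [//|p z IHp].
    rewrite rcons_path last_rcons => /andP[/IHp[ld fl] /eqP <-].
    rewrite mem_next; split=> //.
    have [|//|] := dfg (next d (last x p)); first by rewrite mem_next.
    rewrite [X in _ = g X]fl fK => /eqP; rewrite (negPf (next_next_neq _ _ _)) //.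
  apply: cycle_from_next => // z zd.
  have /connectP[p dp ->] : connect (frel (next d)) x z.
    exact: (connect_cycle (cycle_next Ud)).
  by have [_ ->] := along p dp; apply/eqP.
have [_ [nx|nx]] := dcx x xd.
  have cd : fcycle (next c) d.
    by apply: (propagate _ (prev c)) => // [|z /dcx[]//]; apply: prev_next.
  by have [n ->] := fcycle_next_rot Uc Ud cd xd xc; exists n; left.
have cd : fcycle (next (rev c)) d.
  rewrite (@eq_fcycle _ _ (prev c)); last exact: next_rev.
  apply: (propagate _ (next c)) => // [|z /dcx[_ [|]]]; [exact: next_prev|by right|by left].
have Urc : uniq (rev c) by rewrite rev_uniq.
have xrc : x \in rev c by rewrite mem_rev.
have [n ->] := fcycle_next_rot Urc Ud cd xd xrc.
by exists n; right.
Qed.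

Local Open Scope ring_scope.

(** * Counting closed walks *)

Fixpoint words (U : Type) (L : seq (seq U)) (k : nat) : seq (seq U) :=
  if k is k'.+1 then [seq a ++ s | a <- L, s <- words L k'] else [:: [::]].

Lemma size_words (U : Type) (L : seq (seq U)) k :
  size (words L k) = (size L ^ k)%N.
Proof. by elim: k => //= k IHk; rewrite size_allpairs IHk expnS. Qed.

(** The common length makes the splitting of a concatenation unique. *)
Lemma words_uniq (U : eqType) (L : seq (seq U)) n k :
  uniq L -> {in L, forall a, size a = n} -> uniq (words L k).
Proof.
move=> UL Ln; elim: k => //= k IHk; apply: allpairs_uniq => //.
move=> _ _ /allpairsP[[a s] [/= aL _ ->]] /allpairsP[[b t] [/= bL _ ->]] /=.
by move/eqP; rewrite eqseq_cat ?Ln // => /andP[/eqP -> /eqP ->].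
Qed.

Lemma size_mem_words (U : eqType) (L : seq (seq U)) n k :
  {in L, forall a, size a = n} -> {in words L k, forall s, size s = (n * k)%N}.
Proof.
move=> Ln; elim: k => [|k IHk] s /=; first by rewrite inE muln0 => /eqP->.
case/allpairsP=> [[a t] [/= aL tk ->]].
by rewrite size_cat Ln // IHk // mulnS.
Qed.

Lemma closed_words (U : eqType) (r : rel U) e (L : seq (seq U)) k :
  {in L, forall a, path r e a && (last e a == e)} ->
  {in words L k, forall s, path r e s && (last e s == e)}.
Proof.
move=> Lr; elim: k => [|k IHk] s /=; first by rewrite inE => /eqP-> /=.
case/allpairsP=> [[a t] [/= /Lr/andP[ra /eqP la] /IHk tk ->]].
by rewrite cat_path last_cat ra la.
Qed.

(* Interleaving the two loops in either order gives two closed walks of the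
   same length. *)
Lemma two_closed_walks (U : finType) (r : rel U) e f1 f2 :
    f1 != f2 -> r e f1 -> r e f2 -> connect r f1 e -> connect r f2 e ->
  exists n (L : seq (seq U)), [/\ (0 < n)%N, uniq L, size L = 2%N,
    {in L, forall a, size a = n} &
    {in L, forall a, path r e a && (last e a == e)}].
Proof.
move=> f12 ef1 ef2 /connectP[p1 rp1 l1] /connectP[p2 rp2 l2].
pose a := f1 :: p1; pose b := f2 :: p2.
exists (size a + size b)%N, [:: a ++ b; b ++ a]; split=> //.
- by rewrite /= inE eqseq_cons (negPf f12).
- by move=> s; rewrite !inE => /orP[] /eqP->; rewrite size_cat // addnC.
- by move=> s; rewrite !inE => /orP[] /eqP->;
    rewrite cat_path last_cat /= -l1 -l2 ef1 ef2 rp1 rp2 eqxx.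
Qed.

(** * Vertex walks, edge walks and their weights *)

Lemma nb_walk_cons3 (R : realType) (T : finType) (w : T -> T -> R) x y z s :
  nb_walk w [:: x, y, z & s] =
  [&& is_edge w x y, x != z & nb_walk w [:: y, z & s]].
Proof. by rewrite /nb_walk /= !drop0 -!andbA; do !bool_congr. Qed.

Lemma nb_walk_behead (R : realType) (T : finType) (w : T -> T -> R) x s :
  nb_walk w (x :: s) -> nb_walk w s.
Proof. by case: s => [|y [|z s]] //; rewrite nb_walk_cons3 => /and3P[]. Qed.

Lemma nb_walk_path (R : realType) (T : finType) (w : T -> T -> R) x s :
  nb_walk w (x :: s) -> path (is_edge w) x s.
Proof.
rewrite /nb_walk => /andP[+ _]; elim: s x => //= y s IHs x /andP[-> /IHs].
by [].
Qed.

(** The vertices met along the chained edges [e :: p]; the walk has length [size p + 1], which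
    explains the successor in later indices of [pk]. *)
Definition edge_walk (T : Type) (e : T * T) (p : seq (T * T)) : seq T :=
  [:: e.1, e.2 & map snd p].

Lemma edge_walk_inj (T : eqType) (E : rel T) e p q :
    path (nbstep E) e p -> path (nbstep E) e q ->
  edge_walk e p = edge_walk e q -> p = q.
Proof.
move=> hp hq [].
elim: p e q hp hq => [|f p IHp] e [|g q] //=.
case/andP=> /and4P[_ _ /eqP ef _] hp /andP[/and4P[_ _ /eqP eg _] hq] [fg pq].
have Dfg : f = g by case: f g ef eg fg {hp hq} => [a b] [c d] /= <- <- ->.
by rewrite -Dfg in hq *; rewrite (IHp f q).
Qed.

Lemma nb_edge_walk (R : realType) (T : finType) (w : T -> T -> R) e p :
  is_edge w e.1 e.2 -> path (nbstep (is_edge w)) e p -> nb_walk w (edge_walk e p).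
Proof.
rewrite /edge_walk; elim: p e => [|f p IHp] e Ee; first by rewrite /nb_walk /= Ee.
rewrite [path _ _ _]/= => /andP[/and4P[_ Ef /eqP ef fe] hp].
by rewrite [map _ _]/= nb_walk_cons3 Ee eq_sym fe /= ef IHp.
Qed.

Lemma edge_walk_weight (R : realType) (T : finType) (w : T -> T -> R) e p :
  path (nbstep (is_edge w)) e p ->
  walk_weight w (edge_walk e p) = w e.1 e.2 * \prod_(f <- p) w f.1 f.2.
Proof.
elim: p e => [|f p IHp] e; first by rewrite /walk_weight /steps /= !big_cons !big_nil.
rewrite [path _ _ _]/= => /andP[/and4P[_ _ /eqP ef _] hp].
rewrite big_cons -IHp // /walk_weight /edge_walk /steps /= big_cons ef.
by [].
Qed.

Lemma last_edge_walk (T : Type) x (e : T * T) p :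
  last x (edge_walk e p) = (last e p).2.
Proof. by rewrite /= last_map. Qed.

Lemma pk_ge (R : realType) (T : finType) (w : T -> T -> R) k i j c
    (S : seq (seq T)) :
    (forall i j, 0 <= w i j) -> uniq S ->
    {in S, forall s, [/\ size s = k.+1, nb_walk w s, head i s = i,
                         last i s = j & c <= walk_weight w s]} ->
  c *+ size S <= pk w k i j.
Proof.
move=> w0 US PS.
pose S' := pmap (insub : seq T -> option (k.+1.-tuple T)) S.
have DS : map val S' = S.
  rewrite pmap_filter; last exact: insubK.
  apply/all_filterP/allP => s /PS[ss _ _ _ _].
  by rewrite isSome_insub ss eqxx.
have US' : uniq S' by rewrite -(map_inj_uniq val_inj) DS.
have PS' s : s \in S' -> val s \in S by move=> sS; rewrite -DS map_f.
have -> : size S = #|S'| by rewrite -DS size_map; apply/esym/card_uniqP.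
rewrite -sumr_const /pk [leRHS](bigID [in S']) /=.
rewrite -[leLHS]addr0; apply: lerD; last first.
  by apply: sumr_ge0 => s _; apply: prodr_ge0.
rewrite [leRHS](eq_bigl [in S']) /=; last first.
  move=> s; case: (boolP (s \in S')) => sS; rewrite ?andbF ?andbT //.
  by have [_ -> -> -> _] := PS _ (PS' _ sS); rewrite !eqxx.
by apply: ler_sum => s sS; have [] := PS _ (PS' _ sS).
Qed.

Lemma sigmaV_le (R : realType) (T : finType) (w : T -> T -> R) e f :
  nbstep (is_edge w) e f ->
  0 < sigmaV w <= Num.sqrt (w e.1 e.2 * w f.1 f.2).
Proof.
case/and4P=> Ee Ef ef fe.
pose e' : edge_t w := Sub e Ee; pose f' : edge_t w := Sub f Ef.
have De : hashiV e' f' = Num.sqrt (w e.1 e.2 * w f.1 f.2).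
  by rewrite /hashiV !SubK ef fe.
have in_pos : hashiV e' f' \in pos_entries w.
  apply/mapP; exists (e', f') => //; rewrite mem_enum inE /= De sqrtr_gt0.
  exact: mulr_gt0.
have pos x : x \in pos_entries w -> 0 < x.
  by case/mapP=> ef'; rewrite mem_enum inE => ? ->.
rewrite -De /sigmaV; apply/andP; split; last exact: ge_bigmin_seq.
rewrite big_seq; elim/big_ind: _ => //; last by move=> x y *; rewrite lt_min; apply/andP.
(* The default of the minimum is the head of the list, a positive entry because the list is
   nonempty. *)
by apply: pos; case: (pos_entries w) in_pos => //= x s _; rewrite mem_head.
Qed.

(** Multiply the bounds [sigma <= V_ef] over all steps: every inner edge contributes its square root
    twice, the two end edges once. For a closed path the two end factors cancel. *)
Lemma path_weight_ge (R : realType) (T : finType) (w : T -> T -> R) e p :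
    (forall i j, 0 <= w i j) -> path (nbstep (is_edge w)) e p ->
  sigmaV w ^+ size p * Num.sqrt (w (last e p).1 (last e p).2) <=
  Num.sqrt (w e.1 e.2) * \prod_(f <- p) w f.1 f.2.
Proof.
move=> w0; elim: p e => [|f p IHp] e /=; first by rewrite big_nil mul1r mulr1.
case/andP=> ef hp; have /andP[s0 sle] := sigmaV_le ef.
rewrite big_cons -(sqr_sqrtr (w0 f.1 f.2)) expr2 -mulrA [leRHS]mulrA.
rewrite -(sqrtrM _ (w0 e.1 e.2)) exprS -[leLHS]mulrA.
apply: ler_pM (IHp _ hp) => //; first exact: ltW.
by rewrite mulr_ge0 ?exprn_ge0 ?sqrtr_ge0 ?(ltW s0).
Qed.

Lemma closed_weight_ge (R : realType) (T : finType) (w : T -> T -> R) e p :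
    (forall i j, 0 <= w i j) -> is_edge w e.1 e.2 ->
    path (nbstep (is_edge w)) e p -> last e p = e ->
  sigmaV w ^+ size p <= \prod_(f <- p) w f.1 f.2.
Proof.
move=> w0 Ee hp le; have := path_weight_ge w0 hp.
by rewrite le mulrC ler_pM2l // sqrtr_gt0.
Qed.

Lemma pk_words_ge (R : realType) (T : finType) (w : T -> T -> R) e
    (L : seq (seq (T * T))) n k :
    (forall i j, 0 <= w i j) -> is_edge w e.1 e.2 ->
    uniq L -> {in L, forall a, size a = n} ->
    {in L, forall a, path (nbstep (is_edge w)) e a && (last e a == e)} ->
  w e.1 e.2 * sigmaV w ^+ (n * k) *+ (size L ^ k) <= pk w (n * k).+1 e.1 e.2.
Proof.
move=> w0 Ee UL Ln Lh; pose S := [seq edge_walk e p | p <- words L k].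
have Wh := closed_words Lh; have Wn := size_mem_words Ln.
have US : uniq S.
  rewrite map_inj_in_uniq ?(words_uniq _ UL Ln) // => p q /Wh/andP[hp _] /Wh/andP[hq _].
  exact: (edge_walk_inj hp hq).
rewrite -size_words -(size_map (edge_walk e)); apply: pk_ge => //.
move=> _ /mapP[p pW ->]; have /andP[hp /eqP lp] := Wh _ _ pW; split=> //.
- by rewrite /= size_map (Wn _ _ pW).
- exact: nb_edge_walk.
- by rewrite last_edge_walk lp.
- by rewrite edge_walk_weight // ler_pM2l // -(Wn _ _ pW) (closed_weight_ge w0 Ee).
Qed.

(** The term of index [n * k + 1] is at least [|t| w(e)] times the [k]-th power of the left-hand
    side. Were that side at least 1, the terms could not tend to 0 for [t != 0]. *)
Lemma conv_at_lt (R : realType) (T : finType) (w : T -> T -> R) e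
    (L : seq (seq (T * T))) n t :
    (forall i j, 0 <= w i j) -> is_edge w e.1 e.2 -> (0 < n)%N ->
    uniq L -> {in L, forall a, size a = n} ->
    {in L, forall a, path (nbstep (is_edge w)) e a && (last e a == e)} ->
    conv_at w t ->
  (`|t| * sigmaV w) ^+ n * (size L)%:R < 1.
Proof.
move=> w0 Ee n0 UL Ln Lh ct.
have [->|t0] := eqVneq t 0; first by rewrite normr0 mul0r expr0n gtn_eqF // mul0r.
rewrite ltNge; apply/negP => big.
have /cvg_series_cvg_0/cvgr0Pnorm_lt := ct e.1 e.2.
have eps0 : 0 < `|t| * w e.1 e.2 by rewrite mulr_gt0 ?normr_gt0.
move=> /(_ _ eps0) [N _ /(_ (n * N).+1)] /=.
have -> : (N <= (n * N).+1)%N by rewrite leqW // leq_pmull.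
move=> /(_ isT); apply/negP; rewrite -leNgt.
have p0 : 0 <= pk w (n * N).+1 e.1 e.2.
  by apply: sumr_ge0 => s _; apply: prodr_ge0.
rewrite normrM normrX (ger0_norm p0) exprS -mulrA ler_pM2l ?normr_gt0 //.
apply: le_trans (ler_wpM2l _ (pk_words_ge N w0 Ee UL Ln Lh)); last exact: exprn_ge0.
rewrite -mulr_natr natrX -mulrA mulrCA ler_peMr ?w0 //.
rewrite mulrA -exprMn exprM -exprMn.
exact: exprn_ege1.
Qed.

(** Provides an explicit number below 1 in place of the root [2^(-1/n)], through Bernoulli's
    inequality. *)
Lemma bernoulli_half (R : realType) n :
  (0 < n)%N -> 2^-1 <= (1 - (2 * n%:R)^-1) ^+ n :> R.
Proof.
move=> n0; set x := (2 * n%:R)^-1.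
have n0' : 0 < n%:R :> R by rewrite ltr0n.
have x0 : 0 <= x by rewrite invr_ge0 mulr_ge0 ?ler0n.
have x1 : x <= 1.
  rewrite invf_le1 ?mulr_gt0 // -(natrM _ 2 n) ler1n muln_gt0 n0 //.
have bern m : 1 - m%:R * x <= (1 - x) ^+ m.
  elim: m => [|m IHm]; first by rewrite mul0r subr0.
  rewrite exprS; apply: le_trans (ler_wpM2l _ IHm); last by rewrite subr_ge0.
  rewrite -subr_ge0 -natr1.
  have -> : (1 - x) * (1 - m%:R * x) - (1 - (m%:R + 1) * x) = x * (m%:R * x).
    by ring.
  by rewrite !mulr_ge0 ?ler0n.
apply: le_trans (bern n); rewrite /x invfM mulrCA divff ?mulr1 ?gt_eqF //.
by lra.
Qed.

(** * Cycles of the strong components *)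

Lemma is_edge_irr (R : realType) (T : finType) (w : T -> T -> R) :
  (forall i, w i i = 0) -> irreflexive (is_edge w).
Proof. by move=> w0 x; rewrite /is_edge w0 ltxx. Qed.

(** Take the last vertex that recurs later in the walk: the stretch up to its next occurrence has no
    other repetition. Its length is not 1 for lack of loops, nor 2 as the walk does not
    backtrack. *)
Lemma nb_walk_dcycle (R : realType) (T : finType) (w : T -> T -> R) s :
    (forall i, w i i = 0) -> nb_walk w s -> ~~ uniq s ->
  exists x c, dcycle (is_edge w) (x :: c).
Proof.
move=> w0; elim: s => // x s IHs nbs /=; rewrite negb_and negbK.
have [Us|] := boolP (uniq s); last by move=> nU _; apply: IHs nU; apply: nb_walk_behead nbs.
rewrite orbF => xs; case/splitPr: xs nbs Us => p1 p2 nbs Us.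
exists x, p1; apply/and3P; split.
- case: p1 nbs {Us} => [|y [|z p1]] //= nbs.
    by move/nb_walk_path: nbs; rewrite /= is_edge_irr.
  by move: nbs; rewrite nb_walk_cons3 eqxx andbF.
- move: Us; rewrite cat_uniq /= => /and3P[-> + _].
  by rewrite negb_or andbT => /andP[].
- by move/nb_walk_path: nbs; rewrite cat_path /= rcons_path => /and3P[-> ->].
Qed.

Lemma dcycle_is_cycle (R : realType) (T : finType) (w : T -> T -> R) x c :
    (forall i, w i i = 0) -> dcycle (is_edge w) c -> x \in c ->
  is_cycle w (scc w x) c.
Proof.
move=> w0 /and3P[c3 Uc Ec] xc.
have cC u : u \in c -> u \in scc w x.
  by move=> uc; rewrite inE /reach !(connect_cycle Ec).
apply/and4P; split=> //; first exact/allP.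
apply: sub_in_cycle (allss c) Ec => u v uc vc Euv.
rewrite /uadj !cC //= Euv andbT.
by apply: contraTneq Euv => <-; rewrite is_edge_irr.
Qed.

Lemma is_cycle_scc (R : realType) (T : finType) (w : T -> T -> R) x d :
    is_cycle w (scc w x) d ->
  [/\ (2 < size d)%N, uniq d, cycle (fun u v => is_edge w u v || is_edge w v u) d,
      {in d, forall u, connect (is_edge w) x u /\ connect (is_edge w) u x} &
      {in d &, forall u v, connect (is_edge w) u v}].
Proof.
case/and4P=> d3 Ud /allP dC Cd.
have dx : {in d, forall u, connect (is_edge w) x u /\ connect (is_edge w) u x}.
  by move=> u /dC; rewrite /= inE => /andP[].
split=> //; first by apply: sub_cycle Cd => u v /and4P[].
by move=> u v /dx[_ ux] /dx[xv _]; apply: connect_trans ux xv.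
Qed.

Lemma same_cycle_common (T : finType) (c a b : seq T) :
  same_cycle c a -> same_cycle c b -> same_cycle a b.
Proof.
have unrot (u v : seq T) n : u = rot n v -> exists k, v = rot k u.
  by move=> ->; exists (size (rot n v) - n)%N; rewrite -[RHS]/(rotr n _) rotK.
have revrot (u v : seq T) n : u = rot n v -> exists k, rev u = rot k (rev v).
  by move=> ->; rewrite rev_rot /rotr; eexists.
have rotrot (u v t : seq T) n m : u = rot n v -> v = rot m t -> exists k, u = rot k t.
  by move=> -> ->; rewrite rot_rot_add; eexists.
case=> n [/unrot[k ca]|/unrot[k ca]] [m [bc|bc]].
- by have [l ?] := rotrot _ _ _ _ _ bc ca; exists l; left.
- have [k' ca'] := revrot _ _ _ ca.
  by have [l ?] := rotrot _ _ _ _ _ bc ca'; exists l; right.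
- have [k' ca'] := revrot _ _ _ ca; rewrite revK in ca'.
  by have [l ?] := rotrot _ _ _ _ _ bc ca'; exists l; right.
- by have [l ?] := rotrot _ _ _ _ _ bc ca; exists l; left.
Qed.

(** * Bounds on the radius of convergence *)

Lemma conv_radius_acyclic (R : realType) (T : finType) (w : T -> T -> R) :
    (forall s, nb_walk w s -> uniq s) -> conv_radius w = +oo%E.
Proof.
move=> Uw.
(* A walk of length [k] has [k + 1] vertices, so they cannot be distinct. *)
have pk0 k i j : (#|T| <= k)%N -> pk w k i j = 0.
  move=> kT; apply: big_pred0 => s; apply/negP => /andP[/Uw Us _].
  by have := uniq_leq_size Us (s2 := enum T); rewrite -cardE size_tuple ltnNge kT =>
     /(_ (fun x _ => mem_enum T x)).
have cv t : conv_at w t.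
  move=> i j; apply: (is_cvg_near_cst (\sum_(0 <= k < #|T|) t ^+ k * pk w k i j)).
  exists #|T| => // n /= Tn; rewrite (big_cat_nat (leq0n _) Tn) //=.
  rewrite [X in _ + X]big_nat_cond [X in _ + X]big1 ?addr0 // => k /andP[/andP[Tk _] _].
  by rewrite pk0 ?mulr0.
apply: eq_infty => r; apply: le_trans (ereal_sup_ubound (x := `|r|%:E) _).
  by rewrite lee_fin ler_norm.
by exists r.
Qed.

(** This is [conv_at_lt] for a single closed walk, once around the cycle. The bound is strict at
    each [t], but the supremum keeps only a weak inequality. *)
Lemma dcycle_conv_at_lt (R : realType) (T : finType) (w : T -> T -> R) x c t :
    (forall i j, 0 <= w i j) -> dcycle (is_edge w) (x :: c) -> conv_at w t ->
  0 < sigmaV w /\ `|t| * sigmaV w < 1.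
Proof.
move=> w0 Cc ct; have := dcycle_nbstep Cc; rewrite map_cons.
set e := (x, _); set p := map _ c => /= hp.
have [f ef] : exists f, nbstep (is_edge w) e f.
  by case: (p) hp => [|f q] /= /andP[ef _]; [exists e | exists f].
have Ee : is_edge w e.1 e.2 by case/and4P: ef.
have /andP[s0 _] := sigmaV_le ef; split=> //.
have := @conv_at_lt R T w e [:: rcons p e] (size p).+1 t w0 Ee.
rewrite mulr1 expr_lt1 ?mulr_ge0 ?(ltW s0) //; apply=> // a; rewrite inE => /eqP->.
  by rewrite size_rcons.
by rewrite hp last_rcons eqxx.
Qed.

Lemma scc_branch (R : realType) (T : finType) (w : T -> T -> R) x :
    (forall i, w i i = 0) -> more_than_one_cycle w (scc w x) ->
  exists e f1 f2, let h := nbstep (is_edge w) in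
    [/\ f1 != f2, h e f1, h e f2, connect h f1 e & connect h f2 e].
Proof.
move=> w0 [c0 [d0 [Cc0 Cd0 ncd]]]; have irr := is_edge_irr w0.
have [c3 Uc Ec cx conn] := is_cycle_scc Cc0.
have [y [s [yc Cs]]] := cycle_dcycle irr c3 Uc Ec conn.
have [xy yx] := cx y yc; have /and3P[_ Us Es] := Cs.
(* If both given cycles used only edges of [y :: s], each would be [y :: s] up to rotation and
   reversal, and they would coincide. *)
have [d [Cd dex]] : exists d, is_cycle w (scc w x) d /\
    exists2 u, u \in d & ~~ cycle_edge (y :: s) u (next d u).
  have edge_in d : is_cycle w (scc w x) d -> same_cycle (y :: s) d \/
      exists2 u, u \in d & ~~ cycle_edge (y :: s) u (next d u).
    case/is_cycle_scc => d3 Ud _ _ _.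
    have [/exists_inP|/exists_inPn alld] :=
      boolP [exists u in d, ~~ cycle_edge (y :: s) u (next d u)]; first by right.
    left; apply: cycle_edges_sub => // u ud.
    by have := alld u ud; rewrite negbK.
  have [sc|] := edge_in _ Cc0; last by exists c0.
  have [sd|] := edge_in _ Cd0; last by exists d0.
  by case: ncd; apply: same_cycle_common sc sd.
have [d3 Ud Ed dx dconn] := is_cycle_scc Cd.
have [u [v [s' [ud nuv Cs']]]] := second_dcycle irr Cs d3 Ud Ed dconn dex.
have [xu ux] := dx u ud; have /and3P[_ _ Es'] := Cs'.
have Dv : v = next [:: u, v & s'] u by rewrite /= eqxx.
apply: (two_dcycles_branch Cs Cs' (mem_head _ _) Dv nuv) => a b ac bd.
have ya := connect_cycle Es (mem_head _ _) ac.
have ay := connect_cycle Es ac (mem_head _ _).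
have ub := connect_cycle Es' (mem_head _ _) bd.
have bu := connect_cycle Es' bd (mem_head _ _).
split.
  exact: connect_trans ay (connect_trans yx (connect_trans xu ub)).
exact: connect_trans bu (connect_trans ux (connect_trans xy ya)).
Qed.

Theorem theorem5p3 (R : realType) (T : finType) (w : T -> T -> R)
    (w_ge0 : forall i j, 0 <= w i j) (noloop : forall i, w i i = 0) :
  [/\ (forall x : T, is_tree w (scc w x) \/ isolated_node (scc w x)) ->
        conv_radius w = +oo%E,
      ((forall x : T, ~ more_than_one_cycle w (scc w x)) /\
       (exists x : T, exactly_one_cycle w (scc w x))) ->
        (conv_radius w <= (sigmaV w)^-1%:E)%E
    & (exists x : T, more_than_one_cycle w (scc w x)) ->
        (conv_radius w < (sigmaV w)^-1%:E)%E].
Proof.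
split.
- move=> trees; apply: conv_radius_acyclic => s nbs; apply/negPn/negP => nU.
  have [x [c Cc]] := nb_walk_dcycle noloop nbs nU.
  have Hc := dcycle_is_cycle noloop Cc (mem_head _ _).
  have [[_ /(_ (x :: c))]|C1] := trees x; first by rewrite Hc.
  case/and4P: Hc => c3 Uc /allP cC _.
  have := uniq_leq_size Uc (s2 := enum (scc w x)).
  rewrite -cardE C1 leqNgt (ltn_trans _ c3) // => H.
  by apply: notF; apply: H => u /cC; rewrite mem_enum.
- case=> _ [x [d [Cd _]]]; have [d3 Ud Ed _ conn] := is_cycle_scc Cd.
  have [y [s [_ Cs]]] := cycle_dcycle (is_edge_irr noloop) d3 Ud Ed conn.
  apply: ge_ereal_sup => _ [t ct <-].
  have [s0 ts] := dcycle_conv_at_lt w_ge0 Cs ct.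
  by rewrite lee_fin -[leRHS]mul1r ler_pdivlMr // ltW.
- case=> x /(scc_branch noloop)[e [f1 [f2 [f12 ef1 ef2 f1e f2e]]]].
  have [n [L [n0 UL L2 Ln Lh]]] := two_closed_walks f12 ef1 ef2 f1e f2e.
  have Ee : is_edge w e.1 e.2 by case/and4P: ef1.
  have /andP[s0 _] := sigmaV_le ef1.
  (* Since [q < 1], a bound [q / sigma] uniform in [t] makes the supremum strictly smaller than
     [1 / sigma]; [2 * q ^+ n >= 1] gives this bound. *)
  pose q : R := 1 - (2 * n%:R)^-1.
  have x0 : 0 < (2 * n%:R)^-1 :> R by rewrite invr_gt0 mulr_gt0 ?ltr0n.
  have q_half : 2^-1 <= q ^+ n by apply: bernoulli_half.
  apply: (@le_lt_trans _ _ (q / sigmaV w)%:E); last first.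
    by rewrite lte_fin -[ltRHS]mul1r ltr_pM2r ?invr_gt0 // /q gtrBl.
  apply: ge_ereal_sup => _ [t ct <-]; rewrite lee_fin ler_pdivlMr //.
  have := conv_at_lt w_ge0 Ee n0 UL Ln Lh ct; rewrite L2.
  apply: contraTT; rewrite -ltNge -leNgt => qt.
  have q0 : 0 <= q.
    rewrite subr_ge0 invf_le1 ?mulr_gt0 ?ltr0n // -(natrM _ 2 n) ler1n muln_gt0 n0 //.
  rewrite -ler_pdivrMr // mul1r; apply: le_trans q_half _.
  by rewrite lerXn2r ?nnegrE ?mulr_ge0 ?(ltW s0) ?(ltW qt).
Qed.
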